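(* Let $(\mu^\ast,\phi^\ast,r^\ast)$ be any fixed point of the joint update (so that $\mu^\ast$ is invariant under the soft update with reward $r^\ast$ and temperature $\beta>0$), with $\phi^\ast$ optimal on $\mu^\ast$ and $r^\ast\in\mathcal R_d(\phi^\ast)$ loss-optimal on $\mu^\ast$. Let $\delta\in(0,\tfrac14)$. Then $$\Gamma(\mu^\ast,\phi^\ast;r^\ast,\beta)=0\qquad\text{and}\qquad\Theta(\mu^\ast;r^\ast,\beta)=0.$$
   Context: $\mathcal X$ (prompts) and $\mathcal Y$ (responses) are measurable spaces and $\nu$ is a probability measure on $\mathcal X$. There are $n\ge1$ annotators with measurable utilities $u_i:\mathcal X\times\mathcal Y\to\mathbb R$. Let $F(t)=1/(1+e^{-t})$ and $\bar p(x,y,y')=\frac1n\sum_{i=1}^nF(u_i(x,y)-u_i(x,y'))$. For a kernel $\mu=(\mu_x)_x$ of probability measures on $\mathcal Y$ and a measurable embedding $\phi:\mathcal X\times\mathcal Y\to\mathbb R^d$, $\tilde p_\phi(x,y,y')=\mathbb E_{(y_0,y_0')\sim\mu_x^{\otimes2}}[\bar p(x,y_0,y_0')\mid\phi(x,y_0)=\phi(x,y),\phi(x,y_0')=\phi(x,y')]$. With $\eta=\min\{\tilde p_\phi,1-\tilde p_\phi\}$, $\mathcal R_d(\phi)$ is the set of rewards $r(x,y)=g(\phi(x,y))$, $g:\mathbb R^d\to\mathbb R$ measurable, with $F(r(x,y)-r(x,y'))\in[\eta(x,y,y'),1-\eta(x,y,y')]$ for all $(x,y,y')$. The loss on $\mu$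 is $\mathbb E_{x\sim\nu}\mathbb E_{(y,y')\sim\mu_x^{\otimes2}}[-\bar p\log F(\Delta r)-(1-\bar p)\log(1-F(\Delta r))]$, $\Delta r(x,y,y')=r(x,y)-r(x,y')$; ''loss-optimal on $\mu$'' means minimizing this loss over $\mathcal R_d(\phi)$, and an embedding is ''optimal on $\mu$'' if it attains the smallest such optimal loss among embeddings into $\mathbb R^d$. Joint update: alternately choose an embedding and a loss-minimizing reward $r$ built on it for the current $\mu$, then replace $\mu$ by the soft update $\mu'$ with $d\mu_x'/d\mu_x(y)\propto e^{\beta r(x,y)}$. A fixed point is a triple unchanged by this; in particular the soft update of $\mu^\ast$ with $r^\ast$ equals $\mu^\ast$. $\mathcal{CC}_\infty^{2\delta}$ is the event, for $(x,y_1,y_2,y_3)$, that $\bar p(x,y_1,y_2),\bar p(x,y_2,y_3),\bar p(x,y_3,y_1)$ are all $\ge\frac12+2\delta$ or all $\le\frac12-2\delta$. With $\rho_{r,\beta}(x,y)=e^{\beta r(x,y)}/\mathbb E_{\mu_x}[e^{\beta r(x,\cdot)}]$, $$\Gamma(\mu,\phi;r,\beta)=\mathbb E_{x\sim\nu}\bigl[\mathrm{Cov}_{\mu_x^{\otimes2}}\bigl((\bar p-\tilde p_\phi)^2,\ \rho_{r,\beta}(x,y)\rho_{r,\beta}(x,y')\bigr)\bigr],$$ $$\Theta(\mu;r,\beta)=\mathbb E_{x\sim\nu}\bigl[\mathrm{Cov}_{\mu_x^{\otimes3}}\bigl(\mathbf 1_{\mathcal{CC}_\infty^{2\delta}},\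 \rho_{r,\beta}(x,y_1)\rho_{r,\beta}(x,y_2)\rho_{r,\beta}(x,y_3)\bigr)\bigr].$$ *)

(* Defs.v *)
From HB Require Import structures.
From mathcomp Require Import all_boot all_order all_algebra.
From mathcomp Require Import all_classical all_reals all_analysis.

Set Implicit Arguments.
Unset Strict Implicit.
Unset Printing Implicit Defensive.

Import Order.TTheory GRing.Theory Num.Theory.
Import numFieldNormedType.Exports.

Local Open Scope classical_set_scope.
Local Open Scope ring_scope.

(* The library does not infer a probability structure on the values of a
   probability kernel; [kprob mu x] is [mu x] with that structure. *)
Section kprob.
Context dX dY (X : measurableType dX) (Y : measurableType dY) (R : realType).
Variables (mu : R.-pker X ~> Y) (x : X).

Definition kprob : set Y -> \bar R := mu x.

HB.instance Definition _ := Measure.on kprob.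

Let kprob_setT : kprob [set: Y] = 1%E.
Proof. exact: prob_kernel. Qed.

HB.instance Definition _ := Measure_isProbability.Build _ _ _ kprob kprob_setT.

Definition kprob2 : probability (Y * Y)%type R := (kprob \x kprob)%E.

Definition kprob3 : probability (Y * Y * Y)%type R := (kprob2 \x kprob)%E.

End kprob.

Definition logistic (R : realType) (t : R) : R := (1 + expR (- t))^-1.

Section preference_learning.
Context dX dY (X : measurableType dX) (Y : measurableType dY) (R : realType).
(* [d.-tuple R] carries the product, i.e. Borel, sigma-algebra of R^d. *)
Variables (d n : nat).
Variables (nu : probability X R) (u : 'I_n -> {mfun (X * Y)%type >-> R}).

Local Notation kernelXY := (R.-pker X ~> Y).
Local Notation embedding := {mfun (X * Y)%type >-> d.-tuple R}.
Local Notation reward := (X * Y -> R).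

Definition pbar (x : X) (y y' : Y) : R :=
  n%:R^-1 * \sum_(i < n) logistic (u i (x, y) - u i (x, y')).

(* [p] is a version of
     E_{(y0, y0') ~ mu_x (x) mu_x}
       [pbar(x, y0, y0') | phi(x, y0) = phi(x, y), phi(x, y0') = phi(x, y')]:
   for each [x] it is a function [h (x, _)] of the two embedding values whose
   integral agrees with that of [pbar] on every event that these values
   generate. Such a function is determined only up to a null set, which is why
   the definitions below depend on a choice of versions [pt]. *)
Definition cond_pref_version (mu : kernelXY) (phi : embedding)
    (p : X -> Y -> Y -> R) : Prop :=
  (exists h : {mfun (X * (d.-tuple R * d.-tuple R))%type >-> R},
     forall x y y', p x y y' = h (x, (phi (x, y), phi (x, y')))) /\
  forall x : X,
    (kprob2 mu x).-integrable [set: Y * Y] (fun z => (p x z.1 z.2)%:E) /\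
    forall A : set (d.-tuple R * d.-tuple R), measurable A ->
      let A' := [set z : Y * Y | A (phi (x, z.1), phi (x, z.2))] in
      (\int[kprob2 mu x]_(z in A') (p x z.1 z.2)%:E =
       \int[kprob2 mu x]_(z in A') (pbar x z.1 z.2)%:E)%E.

Definition cond_pref_choice (pt : kernelXY -> embedding -> X -> Y -> Y -> R) :
    Prop :=
  forall mu phi, cond_pref_version mu phi (pt mu phi).

Variables (pt : kernelXY -> embedding -> X -> Y -> Y -> R) (beta : R).

Definition eta (mu : kernelXY) (phi : embedding) (x : X) (y y' : Y) : R :=
  Num.min (pt mu phi x y y') (1 - pt mu phi x y y').

Definition reward_diff (r : reward) (x : X) (y y' : Y) : R :=
  r (x, y) - r (x, y').

Definition reward_class (mu : kernelXY) (phi : embedding) : set reward :=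
  [set r | exists2 g : {mfun d.-tuple R >-> R}, r = g \o phi &
     forall x y y',
       eta mu phi x y y' <= logistic (reward_diff r x y y')
                         <= 1 - eta mu phi x y y'].

(* The integrand is nonnegative, so the loss is always defined, but it may be
   infinite. *)
Definition loss (mu : kernelXY) (r : reward) : \bar R :=
  (\int[nu]_x 'E_(kprob2 mu x)[fun z : Y * Y =>
     (- (pbar x z.1 z.2 * ln (logistic (reward_diff r x z.1 z.2)))
      - (1 - pbar x z.1 z.2) *
          ln (1 - logistic (reward_diff r x z.1 z.2)))%R])%E.

Definition loss_optimal (mu : kernelXY) (phi : embedding) (r : reward) : Prop :=
  reward_class mu phi r /\
  forall r', reward_class mu phi r' -> (loss mu r <= loss mu r')%E.

Definition optimal_loss (mu : kernelXY) (phi : embedding) : \bar R :=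
  ereal_inf [set loss mu r | r in reward_class mu phi].

Definition optimal_embedding (mu : kernelXY) (phi : embedding) : Prop :=
  forall phi' : embedding, (optimal_loss mu phi <= optimal_loss mu phi')%E.

(* [mu'] is a kernel of probability measures, which makes [c] the normalizing
   constant. *)
Definition soft_update (mu : kernelXY) (r : reward) (mu' : kernelXY) : Prop :=
  forall x : X, exists c : R, forall A : set Y, measurable A ->
    mu' x A = (\int[mu x]_(y in A) (c * expR (beta * r (x, y)))%:E)%E.

Definition joint_update (s s' : kernelXY * embedding * reward) : Prop :=
  let: (mu, _, _) := s in
  let: (mu', phi', r') := s' in
  loss_optimal mu phi' r' /\ soft_update mu r' mu'.

Definition fixed_point (s : kernelXY * embedding * reward) : Prop :=
  joint_update s s.

Definition rho (mu : kernelXY) (r : reward) (x : X) (y : Y) : R :=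
  expR (beta * r (x, y)) /
  fine 'E_(kprob mu x)[fun y' : Y => expR (beta * r (x, y'))].

Definition Gamma (mu : kernelXY) (phi : embedding) (r : reward) : \bar R :=
  (\int[nu]_x covariance (kprob2 mu x)
     (fun z : Y * Y => ((pbar x z.1 z.2 - pt mu phi x z.1 z.2) ^+ 2)%R)
     (fun z : Y * Y => (rho mu r x z.1 * rho mu r x z.2)%R))%E.

Definition cyclic_event (delta : R) (x : X) : set (Y * Y * Y) :=
  [set z | let: (y1, y2, y3) := z in
     [/\ 2^-1 + 2 * delta <= pbar x y1 y2,
         2^-1 + 2 * delta <= pbar x y2 y3 &
         2^-1 + 2 * delta <= pbar x y3 y1] \/
     [/\ pbar x y1 y2 <= 2^-1 - 2 * delta,
         pbar x y2 y3 <= 2^-1 - 2 * delta &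
         pbar x y3 y1 <= 2^-1 - 2 * delta]].

Definition Theta (delta : R) (mu : kernelXY) (r : reward) : \bar R :=
  (\int[nu]_x covariance (kprob3 mu x)
     (\1_(cyclic_event delta x))
     (fun z : Y * Y * Y =>
        (rho mu r x z.1.1 * rho mu r x z.1.2 * rho mu r x z.2)%R))%E.

End preference_learning.

(* Main.v *)
(** The soft update multiplies each mu_x by the density c_x e^{beta r(x, .)}.
    If this leaves mu_x unchanged, the density is 1 almost everywhere, so
    e^{beta r(x, .)} is a.e. the constant c_x^{-1}, which is then also its mean:
    rho(x, .) = 1 mu_x-a.e. The products of rho in Gamma and Theta are thus
    a.e. equal to 1 for mu_x^{(x)2} and mu_x^{(x)3}, and a covariance with an
    a.e. constant function vanishes. *)

Require Import Defs.
From HB Require Import structures.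
From mathcomp Require Import all_boot all_order all_algebra.
From mathcomp Require Import all_classical all_reals all_analysis.
From mathcomp Require Import measurable_realfun.

Set Implicit Arguments.
Unset Strict Implicit.
Unset Printing Implicit Defensive.

Import Order.TTheory GRing.Theory Num.Theory.
Import numFieldNormedType.Exports.
Local Open Scope classical_set_scope.
Local Open Scope ring_scope.

(** A null set [N] for [P1] becomes the cylinder [N * T2], whose product measure is [0 * P2 T2 = 0],
    even when [P2] has infinite mass. *)
Lemma ae_product_fst (d1 d2 : measure_display) (T1 : measurableType d1)
    (T2 : measurableType d2) (R : realType) (P1 : {measure set T1 -> \bar R})
    (P2 : {sigma_finite_measure set T2 -> \bar R}) (Q : T1 -> Prop) :
  {ae P1, forall x, Q x} -> {ae (P1 \x P2)%E, forall z, Q z.1}.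
Proof.
move=> [N [mN N0 QN]]; exists (N `*` setT); split.
- exact: measurableX.
- by rewrite product_measure1E// N0 mul0e.
- by move=> z Qz; split => //; apply: QN.
Qed.

Lemma ae_product_snd (d1 d2 : measure_display) (T1 : measurableType d1)
    (T2 : measurableType d2) (R : realType) (P1 : {measure set T1 -> \bar R})
    (P2 : {sigma_finite_measure set T2 -> \bar R}) (Q : T2 -> Prop) :
  {ae P2, forall y, Q y} -> {ae (P1 \x P2)%E, forall z, Q z.2}.
Proof.
move=> [N [mN N0 QN]]; exists (setT `*` N); split.
- exact: measurableX.
- by rewrite product_measure1E// N0 mule0.
- by move=> z Qz; split => //; apply: QN.
Qed.

(** Uniqueness of densities: [f] and the constant 1 have equal integrals over every measurable set.
    Integrability is checked on the constant, so [f] only has to be measurable. *)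
Lemma ae_density_self (d : measure_display) (T : measurableType d)
    (R : realType) (P : probability T R) (f : T -> R) :
  measurable_fun setT f ->
  (forall A, measurable A -> P A = \int[P]_(x in A) (f x)%:E)%E ->
  {ae P, forall x, f x = 1}.
Proof.
move=> mf Pf.
have : ae_eq P setT (cst 1%E) (EFin \o f).
  apply: integral_ae_eq => //.
  - exact: finite_measure_integrable_cst.
  - exact/measurable_EFinP.
  - by move=> E _ mE; rewrite integral_cst// mul1e; exact: Pf.
by apply: filterS => x /(_ I) [].
Qed.

Lemma ae_cst_expectation (d : measure_display) (T : measurableType d)
    (R : realType) (P : probability T R) (f : T -> R) (c : R) :
  measurable_fun setT f -> {ae P, forall x, f x = c} -> 'E_P[f]%E = c%:E.
Proof.
move=> mf fc; rewrite -(expectation_cst P c) !unlock.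
apply: ae_eq_integral => //; [exact/measurable_EFinP..|].
by apply: filterS fc => x ->.
Qed.

(** Whatever real number [fine] returns for the mean of [f], the centred product has the factor
    [g - c], which is zero almost everywhere. *)
Lemma ae_cst_covariance (d : measure_display) (T : measurableType d)
    (R : realType) (P : probability T R) (f g : T -> R) (c : R) :
  measurable_fun setT f -> measurable_fun setT g ->
  {ae P, forall x, g x = c} -> covariance P f g = 0%E.
Proof.
move=> mf mg gc; rewrite unlock (ae_cst_expectation mg gc)/=.
apply: ae_cst_expectation.
- by apply: measurable_funM; apply: measurable_funB.
- by apply: filterS gc => x gx; rewrite mulrfctE/= gx subrr mulr0.
Qed.

Lemma measurable_logistic (R : realType) :
  measurable_fun setT (@logistic R).
Proof.
apply: continuous_measurable_fun => t.
rewrite /logistic; apply: cvgV; first by rewrite gt_eqF// addr_gt0// expR_gt0.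
apply: cvgD; first exact: cvg_cst.
by apply: continuous_comp; [exact: continuousN|exact: continuous_expR].
Qed.

(** The general source [Z] lets one statement serve both for pairs of responses and for any two
    coordinates of a triple. *)
Lemma measurable_pbar (R : realType) (dX dY dZ : measure_display)
    (X : measurableType dX) (Y : measurableType dY) (Z : measurableType dZ)
    (n : nat) (u : 'I_n -> {mfun (X * Y)%type >-> R}) (x : X) (f g : Z -> Y) :
  measurable_fun setT f -> measurable_fun setT g ->
  measurable_fun setT (fun z => pbar u x (f z) (g z)).
Proof.
move=> mf mg; apply: measurable_funM => //; apply: measurable_sum => i.
apply: (measurableT_comp (@measurable_logistic R)).
by apply: measurable_funB; apply: measurableT_comp => //;
  exact: measurable_fun_pair.
Qed.

Lemma measurable_cyclic_event (R : realType) (dX dY : measure_display)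
    (X : measurableType dX) (Y : measurableType dY) (n : nat)
    (u : 'I_n -> {mfun (X * Y)%type >-> R}) (delta : R) (x : X) :
  measurable (cyclic_event u delta x).
Proof.
pose p (f g : Y * Y * Y -> Y) z := pbar u x (f z) (g z).
have m1 : measurable_fun setT (fun z : Y * Y * Y => z.1.1).
  exact: measurableT_comp.
have m2 : measurable_fun setT (fun z : Y * Y * Y => z.1.2).
  exact: measurableT_comp.
have m3 : measurable_fun setT (fun z : Y * Y * Y => z.2).
  exact: measurable_snd.
pose a : R := 2^-1 + 2 * delta; pose b : R := 2^-1 - 2 * delta.
have mge f g : measurable_fun setT f -> measurable_fun setT g ->
    measurable [set z | a <= p f g z].
  move=> mf mg; rewrite -[X in measurable X]setTI.
  by apply: measurable_fun_le => //; exact: measurable_pbar.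
have mle f g : measurable_fun setT f -> measurable_fun setT g ->
    measurable [set z | p f g z <= b].
  move=> mf mg; rewrite -[X in measurable X]setTI.
  by apply: measurable_fun_le => //; exact: measurable_pbar.
(* Replacing the destructuring pattern by projections exhibits the event as a finite combination of
   level sets of measurable functions. *)
have -> : cyclic_event u delta x =
    ([set z | a <= p (fun z => z.1.1) (fun z => z.1.2) z] `&`
     [set z | a <= p (fun z => z.1.2) (fun z => z.2) z] `&`
     [set z | a <= p (fun z => z.2) (fun z => z.1.1) z]) `|`
    ([set z | p (fun z => z.1.1) (fun z => z.1.2) z <= b] `&`
     [set z | p (fun z => z.1.2) (fun z => z.2) z <= b] `&`
     [set z | p (fun z => z.2) (fun z => z.1.1) z <= b]).
  apply/seteqP; split => -[[y1 y2] y3].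
  - by case=> -[? ? ?]; [left|right].
  - by case=> -[[? ?] ?]; [left|right].
by apply: measurableU; apply: measurableI; do ?apply: measurableI;
  (apply: mge || apply: mle).
Qed.

(** A version factors through a jointly measurable [h], so its section at a fixed [x] is a
    composition of measurable maps. *)
Lemma measurable_cond_pref_version (R : realType) (dX dY : measure_display)
    (X : measurableType dX) (Y : measurableType dY) (d n : nat)
    (u : 'I_n -> {mfun (X * Y)%type >-> R}) (mu : R.-pker X ~> Y)
    (phi : {mfun (X * Y)%type >-> d.-tuple R}) (p : X -> Y -> Y -> R) (x : X) :
  cond_pref_version u mu phi p ->
  measurable_fun setT (fun z : Y * Y => p x z.1 z.2).
Proof.
move=> [[h hE] _]; under eq_fun do rewrite hE.
apply: measurableT_comp => //; apply: measurable_fun_pair => //.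
by apply: measurable_fun_pair; apply: measurableT_comp => //;
  exact: measurable_fun_pair.
Qed.

Lemma measurable_reward_class (R : realType) (dX dY : measure_display)
    (X : measurableType dX) (Y : measurableType dY) (d : nat)
    (pt : R.-pker X ~> Y -> {mfun (X * Y)%type >-> d.-tuple R} ->
          X -> Y -> Y -> R)
    (mu : R.-pker X ~> Y) (phi : {mfun (X * Y)%type >-> d.-tuple R})
    (r : X * Y -> R) :
  reward_class pt mu phi r -> measurable_fun setT r.
Proof. by move=> [g -> _]; exact: measurableT_comp. Qed.

Lemma measurable_rho (R : realType) (dX dY : measure_display)
    (X : measurableType dX) (Y : measurableType dY) (beta : R)
    (mu : R.-pker X ~> Y) (r : X * Y -> R) (x : X) :
  measurable_fun setT r -> measurable_fun setT (rho beta mu r x).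
Proof.
move=> mr; apply: measurable_funM => //; apply: measurableT_comp => //.
by apply: measurable_funM => //; exact: measurable_fun_pair2.
Qed.

Lemma soft_update_fixed_rho (R : realType) (dX dY : measure_display)
    (X : measurableType dX) (Y : measurableType dY) (beta : R)
    (mu : R.-pker X ~> Y) (r : X * Y -> R) (x : X) :
  measurable_fun setT r -> soft_update beta mu r mu ->
  {ae kprob mu x, forall y, rho beta mu r x y = 1}.
Proof.
move=> mr /(_ x)[c cE].
have mexp : measurable_fun setT (fun y => expR (beta * r (x, y))).
  apply: measurableT_comp => //.
  by apply: measurable_funM => //; exact: measurable_fun_pair2.
(* With [mu] on both sides of the soft update, [c * expR (beta * r (x, y))] is a density of [mu x]
   with respect to itself. *)
have {cE} c1 : {ae kprob mu x, forall y, c * expR (beta * r (x, y)) = 1}.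
  by apply: ae_density_self => //; exact: measurable_funM.
have exp_cst : {ae kprob mu x, forall y, expR (beta * r (x, y)) = c^-1}.
  apply: filterS c1 => y cy; rewrite -[RHS]mulr1 -cy mulKf//.
  (* Cancelling [c] requires [c != 0]: otherwise the product, equal to 1, would be 0. *)
  by apply: contra_eq_neq cy => ->; rewrite mul0r eq_sym oner_eq0.
rewrite /rho (ae_cst_expectation mexp exp_cst)/=.
by apply: filterS c1 => y; rewrite invrK mulrC.
Qed.

Theorem proposition5p2 (R : realType) (dX dY : measure_display)
    (X : measurableType dX) (Y : measurableType dY)
    (nu : probability X R)
    (n : nat) (n_ge1 : (1 <= n)%N)
    (u : 'I_n -> {mfun (X * Y)%type >-> R})
    (d : nat)
    (pt : R.-pker X ~> Y -> {mfun (X * Y)%type >-> d.-tuple R} ->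
          X -> Y -> Y -> R)
    (ptP : cond_pref_choice u pt)
    (beta : R) (beta_gt0 : 0 < beta)
    (delta : R) (delta_gt0 : 0 < delta) (delta_lt : delta < 4^-1)
    (mu : R.-pker X ~> Y) (phi : {mfun (X * Y)%type >-> d.-tuple R})
    (r : X * Y -> R)
    (fixed : fixed_point nu u pt beta (mu, phi, r))
    (phi_optimal : optimal_embedding nu u pt mu phi)
    (r_optimal : loss_optimal nu u pt mu phi r) :
  Gamma nu u pt beta mu phi r = 0%E /\ Theta nu u beta delta mu r = 0%E.
Proof.
have [_ mu_fixed] := fixed.
have mr : measurable_fun setT r by case: r_optimal => /measurable_reward_class.
have rho1 x := soft_update_fixed_rho x mr mu_fixed.
have mrho x : measurable_fun setT (rho beta mu r x) by exact: measurable_rho.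
have rho2 x : {ae kprob2 mu x,
    forall z, rho beta mu r x z.1 * rho beta mu r x z.2 = 1}.
  apply: filterS2 (ae_product_fst (kprob mu x) (rho1 x))
    (ae_product_snd (kprob mu x) (rho1 x)) => z -> ->.
  by rewrite mulr1.
have mrho2 x : measurable_fun setT
    (fun z => rho beta mu r x z.1 * rho beta mu r x z.2).
  by apply: measurable_funM; exact: measurableT_comp.
(* The covariances vanish at every prompt [x], since invariance is stated pointwise in [x]; the
   outer integrands are identically zero. *)
split; apply: integral0_eq => x _.
- apply: ae_cst_covariance (rho2 x) => //.
  apply: measurable_funX; apply: measurable_funB; first exact: measurable_pbar.
  exact: (measurable_cond_pref_version x (ptP mu phi)).
- apply: (@ae_cst_covariance _ _ _ _ _ _ 1).
  + by apply: measurable_indic; exact: measurable_cyclic_event.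
  + apply: measurable_funM; last exact: measurableT_comp.
    exact: measurableT_comp (mrho2 x) _.
  (* [kprob3] is associated to the left, so the pair identity [rho2] lifts along the first
     projection and [rho1] along the second. *)
  + apply: filterS2 (ae_product_fst (kprob mu x) (rho2 x))
      (ae_product_snd (kprob2 mu x) (rho1 x)) => z -> ->.
    by rewrite mulr1.
Qed.
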